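(* Let $X$ be a Banach space with a normalized monotone basis, let $\sigma\subset\Sigma(X)$ be N-analytic and large for $X$, and let $\Delta=(\delta_1,\delta_2,\dots)$ be a sequence of positive real numbers. Then there is a block subspace $Y$ of $X$ such that $\sigma_\Delta$ is strategically large for $Y$.
   Context: Banach spaces and subspaces are infinite-dimensional. $X$ comes with a fixed normalized basis $(e_n)_{n=1}^\infty$ which is monotone (all the projections $\sum_{n=1}^\infty a_ne_n\mapsto\sum_{n=1}^N a_ne_n$ have norm at most $1$). For vectors, $x<y$ means $\max\operatorname{supp}(x)<\min\operatorname{supp}(y)$, with supports taken with respect to $(e_n)$. A block subspace is the closed linear span of an infinite sequence $x_1<x_2<\cdots$ of nonzero vectors. $S(X)$ is the unit sphere of $X$. $\Sigma(X)$ is the set of all infinite sequences $((x_n,\lambda_n))_{n=1}^\infty$ of pairs in $S(X)\times[0,1]$ with $x_1<x_2<\cdots$. Such a sequence is said to be contained in a subspace $Y$ if all $x_n\in Y$. Put $d((x,\lambda),(y,\mu))=\|x-y\|+|\lambda-\mu|$ on $S(X)\times[0,1]$. The N-topology on $\Sigma(X)$ is the topology induced by the product topology on $(S(X)\times[0,1])^{\mathbb N}$ coming from $d$ (it makes $\Sigma(X)$ a Polish space); N-analytic means analytic (a continuous image of $\mathbb N^{\mathbb N}$, or empty) in this topology. $\sigma_\Delta$ is the set of sequences $(u_n)\in\Sigma(X)$ for which there is $(v_n)\in\sigma$ with $d(u_n,v_n)\le\delta_n$ for every $n$. $\sigma$ is large for $X$ if every block subspace of $X$ contains a sequence in $\sigma$.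 $\sigma$ is strategically large for a block subspace $Y$ if player P has a winning strategy in the following infinite game $\sigma[Y]$: on the $n$th move player S chooses a block subspace $X_n\subset Y$ and then player P chooses a pair $(x_n,\lambda_n)\in S(X)\times[0,1]$ with $x_n\in X_n$; P wins if the resulting infinite sequence belongs to $\sigma$. (A strategy for P gives P's next move as a function of the previous moves of P and the current subspace $X_n$.) *)

(* Defs.v *)
From HB Require Import structures.
From mathcomp Require Import all_boot all_order all_algebra.
From mathcomp Require Import all_classical all_reals.
From mathcomp Require Import topology normedtype sequences.
From mathcomp Require Import complex.

Set Implicit Arguments.
Unset Strict Implicit.
Unset Printing Implicit Defensive.

Import Order.TTheory GRing.Theory Num.Theory.
Import numFieldNormedType.Exports.

Local Open Scope classical_set_scope.
Local Open Scope ring_scope.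

(* Banach spaces are real or complex. Over R[i] norms take their values in
   R[i], and since 0 <= z in R[i] forces z to be real, the conditions
   0 <= l <= 1 and 0 < delta n below still denote real numbers. *)
Definition real_or_complex (R : realType) (K : numFieldType) : Prop :=
  K = (R : numFieldType) \/ K = (R[i] : numFieldType).

Definition analytic (T : topologicalType) (A : set T) : Prop :=
  A = set0 \/
  exists f : {ptws nat -> nat} -> T, continuous f /\ range f = A.

Section BlockSequences.
Variables (K : numFieldType) (X : completeNormedModType K) (e : nat -> X).

Definition is_expansion (a : nat -> K) (x : X) : Prop :=
  series (fun n => a n *: e n) @ \oo --> x.

Definition schauder_basis : Prop :=
  forall x : X, exists! a : nat -> K, is_expansion a x.

Definition normalized : Prop := forall n, `|e n| = 1.

Definition monotone_basis : Prop :=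
  forall (a : nat -> K) (x : X), is_expansion a x ->
  forall N, `|\sum_(0 <= n < N) a n *: e n| <= `|x|.

Definition supp (x : X) : set nat :=
  [set n | exists a : nat -> K, is_expansion a x /\ a n != 0].

(* For nonzero x and y this says that max (supp x) exists and is smaller than
   min (supp y); it is only used between nonzero vectors. *)
Definition before (x y : X) : Prop :=
  forall i j, supp x i -> supp y j -> (i < j)%N.

Definition linear_span (x : nat -> X) : set X :=
  [set v | exists n (a : nat -> K), v = \sum_(i < n) a i *: x i].

Definition block_subspace (Y : set X) : Prop :=
  exists x : nat -> X,
    [/\ forall n, x n != 0,
        forall n, before (x n) (x n.+1)
      & Y = closure (linear_span x)].

(* The product of the unit sphere with the unit interval. *)
Definition sphere_itv : set (X * K) :=
  [set p | `|p.1| = 1 /\ 0 <= p.2 <= 1].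

Definition Sigma : set (nat -> X * K) :=
  [set s | (forall n, sphere_itv (s n)) /\
           (forall n, before (s n).1 (s n.+1).1)].

(* The topology of Sigma is induced by the product topology, so for a subset
   of Sigma it is the same to be a continuous image of the Baire space in
   Sigma or in the whole space of sequences. *)
Definition N_analytic (sigma : set (nat -> X * K)) : Prop :=
  analytic (sigma : set {ptws nat -> (X * K)%type}).

Definition large (sigma : set (nat -> X * K)) : Prop :=
  forall Y, block_subspace Y ->
  exists s, sigma s /\ forall n, Y (s n).1.

Definition pair_dist (u v : X * K) : K := `|u.1 - v.1| + `|u.2 - v.2|.

Definition enlargement (delta : nat -> K) (sigma : set (nat -> X * K)) :
    set (nat -> X * K) :=
  [set u | Sigma u /\
     exists v, sigma v /\ forall n, pair_dist (u n) (v n) <= delta n].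

(* A strategy for P: the previous moves of P, in chronological order, and the
   subspace just chosen by S determine the next move of P. *)
Definition strategy := seq (X * K) -> set X -> X * K.

Fixpoint history (st : strategy) (Z : nat -> set X) (n : nat) : seq (X * K) :=
  if n is m.+1 then
    rcons (history st Z m) (st (history st Z m) (Z m))
  else [::].

Definition play (st : strategy) (Z : nat -> set X) (n : nat) : X * K :=
  st (history st Z n) (Z n).

(* Against all legal moves of S, a winning strategy makes only legal moves and
   produces a sequence in sigma. *)
Definition winning (sigma : set (nat -> X * K)) (Y : set X) (st : strategy) :
    Prop :=
  forall Z : nat -> set X,
    (forall n, block_subspace (Z n) /\ Z n `<=` Y) ->
    (forall n, sphere_itv (play st Z n) /\ Z n (play st Z n).1) /\
    sigma (play st Z).

Definition strategically_large (sigma : set (nat -> X * K)) (Y : set X) :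
    Prop :=
  exists st : strategy, winning sigma Y st.

End BlockSequences.

(* Main.v *)
Require Import Defs.
From HB Require Import structures.
From mathcomp Require Import all_boot all_order all_algebra.
From mathcomp Require Import all_classical all_reals.
From mathcomp Require Import topology normedtype sequences.
From mathcomp Require Import complex.

Set Implicit Arguments.
Unset Strict Implicit.
Unset Printing Implicit Defensive.

Import Order.TTheory GRing.Theory Num.Theory.
Import numFieldNormedType.Exports.

Local Open Scope classical_set_scope.
Local Open Scope ring_scope.

(* P aims at a sequence w of sigma, written as w = F(alpha) with F continuous
   on the Baire space. A position (p, s) consists of approximations p of the
   first vectors, drawn from finite nets, and of an initial segment s of alpha;
   it is large if every block subspace contains the rest of some F(beta) with
   beta extending s whose first terms are close to p. Diagonalizing over the
   positions gives a block subspace W in which largeness is decided, so that an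
   initial segment of a single such F(beta) in W yields large positions.
   Consider the finite game in which P, starting from a large (p, s), tries to
   reach some p' and a letter k with (p', sk) large. If P could not win it in
   any subspace, a second diagonalization would produce a block subspace in
   which P, whatever he plays, never gets there; but largeness of (p, s) gives
   an F(beta) in this subspace, a long initial segment of which is such a p'.
   So, after a further diagonalization, P wins these finite games in one block
   subspace Y. Playing them one after the other he builds alpha letter by
   letter, and by continuity his moves stay within the allowed distance of
   F(alpha). P is allowed to wait before naming the next letter because a
   diagonalization can only take care of finitely many segments s at a time. *)

(** * Finite nets of scalars, and convergence in the Baire space *)

(** The radius 2 is the bound that [coord_norm] gives for the coordinates of a unit vector. *)
Lemma real_net (R : realType) (eps : R) : 0 < eps ->
  exists s : seq R, forall x : R, `|x| <= 2 ->
    exists2 g, g \in s & `|x - g| <= eps.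
Proof.
move=> eps0; exists [seq i%:R * eps - 2 | i <- iota 0 (Num.truncn (4 / eps)).+1].
move=> x; rewrite ler_norml => /andP[x2 x2'].
have x20 : 0 <= (x + 2) / eps by apply: divr_ge0 (ltW eps0); rewrite -lerBlDr sub0r.
have /andP[ix xi] := truncn_itv x20.
exists ((Num.truncn ((x + 2) / eps))%:R * eps - 2).
  apply/mapP; exists (Num.truncn ((x + 2) / eps)) => //.
  rewrite mem_iota/= add0n ltnS.
  apply: le_truncn; rewrite ler_pM2r ?invr_gt0//.
  by rewrite (_ : 4 = 2 + 2) ?lerD2r// -natrD.
rewrite opprB addrA ger0_norm ?subr_ge0; last by rewrite -ler_pdivlMr.
rewrite lerBlDr; move: xi; rewrite ltr_pdivrMr// -[(Num.truncn _).+1%:R]natr1.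
rewrite mulrDl mul1r [ltRHS]addrC.
exact: ltW.
Qed.

Lemma scalar_net (R : realType) (K : numFieldType) (eps : K) :
  real_or_complex R K -> 0 < eps ->
  exists s : seq K, forall x : K, `|x| <= 2 ->
    exists2 g, g \in s & `|x - g| <= eps.
Proof.
move=> RK; case: RK eps => ->; first exact: real_net.
(* A positive element of [R[i]] is real, so [eps] reduces to its real part [a]. *)
case=> a b; rewrite ltcE/= => /andP[/eqP -> a0].
have [s sP] := real_net (divr_gt0 a0 (ltr0Sn _ 1)).
exists [seq Complex x y | x <- s, y <- s] => -[x y] xy2.
have part (z : R) : `|z|%:C%C <= `|Complex x y| -> `|z| <= 2.
  move=> /le_trans/(_ xy2); rewrite (_ : 2 = 2%:R%:C%C) ?lecR//.
  by rewrite rmorph_nat.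
have [|g gs xg] := sP x; first by apply: part; exact: (normc_ge_Re (Complex x y)).
have [|h hs yh] := sP y.
  apply: part; rewrite normc_def lecR/= -(sqrtr_sqr y) ler_sqrt.
    by rewrite lerDr sqr_ge0.
  by rewrite addr_ge0 ?sqr_ge0.
exists (Complex g h); first exact: allpairs_f.
rewrite normc_def/= lecR (le_trans _ (_ : `|x - g| + `|y - h| <= a))//; last first.
  by rewrite [leRHS]splitr lerD.
rewrite -[leRHS]ger0_norm ?addr_ge0//.
rewrite -[leRHS]sqrtr_sqr ler_sqrt ?sqr_ge0//.
rewrite [leRHS]sqrrD !real_normK ?num_real//.
by rewrite addrAC lerDl mulrn_wge0// mulr_ge0.
Qed.

(** In a product of discrete spaces, a sequence whose coordinates are eventually constant converges;
    continuity of [f] does the rest. *)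
Lemma ptws_cvg (T : uniformType) (f : {ptws nat -> nat} -> {ptws nat -> T})
    (u : nat -> nat -> nat) (a : nat -> nat) :
  continuous f -> (forall i, \forall k \near \oo, u k i = a i) ->
  forall i, f (u k) i @[k --> \oo] --> f a i.
Proof.
move=> cf ua.
have : (fun k => f (u k)) @ \oo --> (f a : {ptws nat -> T}).
  apply: (@cvg_comp _ _ _ u f _ (nbhs (a : {ptws nat -> nat}))); last exact: cf.
  apply/pointwise_cvgP => i.
  have ui : \forall k \near \oo, u k i = a i by exact: ua.
  by apply: cvg_near_cst; exact: ui.
by move=> /pointwise_cvgP.
Qed.

(** * Coordinates and supports *)

Section Gowers.
Variables (K : numFieldType) (X : completeNormedModType K) (e : nat -> X).
Hypotheses (basis_e : schauder_basis e) (normalized_e : normalized e).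
Hypothesis monotone_e : monotone_basis e.

Definition coord (x : X) : nat -> K :=
  xget (fun=> 0) [set a | is_expansion e a x].

Lemma coord_expansion x : is_expansion e (coord x) x.
Proof.
have [a [ax _]] := basis_e x.
exact: (@xgetI _ (fun=> 0) [set a | is_expansion e a x] a).
Qed.

Lemma expansion_coord a x : is_expansion e a x -> coord x = a.
Proof.
by have [b [bx uniq_b]] := basis_e x => ax;
  rewrite -(uniq_b _ ax) -(uniq_b _ (@coord_expansion x)).
Qed.

Lemma coordD x y n : coord (x + y) n = coord x n + coord y n.
Proof.
rewrite (@expansion_coord (fun n => coord x n + coord y n)) //.
rewrite /is_expansion.
have -> : series (fun n => (coord x n + coord y n) *: e n) =
    series (fun n => coord x n *: e n) + series (fun n => coord y n *: e n).
  apply/funext => N; rewrite /series/= fctE -big_split/=.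
  by apply: eq_bigr => i _; rewrite scalerDl.
by apply: cvgD; exact: coord_expansion.
Qed.

Lemma coordZ k x n : coord (k *: x) n = k * coord x n.
Proof.
rewrite (@expansion_coord (fun n => k * coord x n)) //.
rewrite /is_expansion.
have -> : series (fun n => (k * coord x n) *: e n) =
    k *: series (fun n => coord x n *: e n).
  apply/funext => N; rewrite /series/= fctE scaler_sumr.
  by apply: eq_bigr => i _; rewrite scalerA.
by apply: cvgZl_tmp; exact: coord_expansion.
Qed.

Lemma coord0 n : coord 0 n = 0.
Proof. by rewrite -[0 in LHS](scale0r 0) coordZ mul0r. Qed.

Lemma coordB x y n : coord (x - y) n = coord x n - coord y n.
Proof. by rewrite coordD -scaleN1r coordZ mulN1r. Qed.

Lemma coord_sum N (u : 'I_N -> X) n :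
  coord (\sum_(i < N) u i) n = \sum_(i < N) coord (u i) n.
Proof.
elim: N u => [|N IHN] u; first by rewrite !big_ord0 coord0.
by rewrite !big_ord_recr/= coordD IHN.
Qed.

(** A term of the expansion is the difference of two partial sums, and monotonicity bounds each by
    the norm of [x]. *)
Lemma coord_norm x n : `|coord x n| <= 2 * `|x|.
Proof.
have /monotone_e bound := @coord_expansion x.
rewrite (_ : `|coord x n| = `|coord x n *: e n|); last first.
  by rewrite normrZ normalized_e mulr1.
have -> : coord x n *: e n = \sum_(0 <= i < n.+1) coord x i *: e i
                           - \sum_(0 <= i < n) coord x i *: e i.
  by rewrite big_nat_recr//= [RHS]addrC addKr.
apply: le_trans (ler_normB _ _) _.
by rewrite mulr_natl mulr2n; apply: lerD; exact: bound.
Qed.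

Lemma suppE x n : supp e x n <-> coord x n != 0.
Proof.
split=> [[a [/expansion_coord -> //]]|xn].
by exists (coord x); split => //; exact: coord_expansion.
Qed.

Lemma beforeE x y : before e x y <->
  forall i j, coord x i != 0 -> coord y j != 0 -> (i < j)%N.
Proof.
by split=> xy i j xi yj; apply: xy; apply/suppE.
Qed.

Definition finsupp (N : nat) (x : X) : Prop :=
  forall n, (N <= n)%N -> coord x n = 0.

Lemma finsuppW M N x : (M <= N)%N -> finsupp M x -> finsupp N x.
Proof. by move=> MN Mx n Nn; apply: Mx; exact: leq_trans Nn. Qed.

Lemma finsupp_sum N x : finsupp N x -> x = \sum_(i < N) coord x i *: e i.
Proof.
move=> Nx; have cx := @coord_expansion x.
apply: (@norm_cvg_unique _ _ (series (fun n => coord x n *: e n) @ \oo)) => //.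
have : series (fun n => coord x n *: e n) n @[n --> \oo] -->
   \sum_(i < N) coord x i *: e i.
  apply: cvg_near_cst; exists N => // n /= Nn.
  rewrite /series/= (big_cat_nat (n := N))//= big_mkord.
  rewrite -[RHS]addr0; congr (_ + _); rewrite big_nat_cond big1// => i.
  by rewrite andbT => /andP[/Nx -> _]; rewrite scale0r.
exact.
Qed.

Lemma coord_neq0 x : x != 0 -> exists n, coord x n != 0.
Proof.
move=> x0; apply: contrapT => /forallNP cx; move/eqP: x0; apply.
have := @finsupp_sum 0 x; rewrite big_ord0; apply => n _.
by apply/eqP; apply: contrapT => /negP; exact: cx.
Qed.

Lemma before_finsupp x y : y != 0 -> before e x y -> exists N, finsupp N x.
Proof.
move=> /coord_neq0[j yj] /beforeE xy; exists j => n jn.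
apply/eqP; apply: contrapT => /negP xn.
by have := xy _ _ xn yj; rewrite ltnNge jn.
Qed.

Lemma before_trans x y z : y != 0 ->
  before e x y -> before e y z -> before e x z.
Proof.
move=> /coord_neq0[j yj] /beforeE xy /beforeE yz; apply/beforeE => i k xi zk.
exact: ltn_trans (xy _ _ xi yj) (yz _ _ yj zk).
Qed.

Lemma finsupp_before N x y : finsupp N x ->
  (forall n, (n < N)%N -> coord y n = 0) -> before e x y.
Proof.
move=> Nx Ny; apply/beforeE => i j xi yj; apply: (@leq_trans N).
  by rewrite ltnNge; apply: contra xi => /Nx ->.
by rewrite leqNgt; apply: contra yj => /Ny ->.
Qed.

Lemma before_finsuppl N x y : y != 0 -> before e x y -> finsupp N y ->
  finsupp N x.
Proof.
move=> /coord_neq0[j yj] /beforeE xy Ny n Nn.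
apply/eqP; apply: contrapT => /negP xn.
have := xy _ _ xn yj; rewrite ltnNge => /negP; apply.
rewrite (leq_trans _ Nn)// ltnW// ltnNge.
by apply: contra yj => /Ny ->.
Qed.

Lemma coord_inj x y : (forall n, coord x n = coord y n) -> x = y.
Proof.
move=> xy; apply/eqP; rewrite -subr_eq0; apply: contrapT => /negP.
by move=> /coord_neq0[n]; rewrite coordB xy subrr eqxx.
Qed.

Lemma closure_approx (A : set X) x : closure A x ->
  forall eps : K, 0 < eps -> exists2 y, A y & `|x - y| < eps.
Proof.
move=> Ax eps eps0; have [y [Ay xy]] := Ax _ (nbhsx_ballx x eps eps0).
by exists y => //; rewrite -ball_normE in xy.
Qed.

Lemma approx_closure (A : set X) x :
  (forall eps : K, 0 < eps -> exists2 y, A y & `|x - y| < eps) -> closure A x.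
Proof.
move=> Ax B /nbhs_ballP[eps /= eps0 xB].
have [y Ay xy] := Ax _ eps0; exists y; split => //.
by apply: xB; rewrite -ball_normE.
Qed.

(** * Closed subspaces and closed spans *)

Definition closed_subspace (Y : set X) : Prop :=
  [/\ closure Y `<=` Y, Y 0
    & forall k x y, Y x -> Y y -> Y (k *: x + y)].

Lemma closed_subspace_sum Y N (u : nat -> X) : closed_subspace Y ->
  (forall i, (i < N)%N -> Y (u i)) -> Y (\sum_(i < N) u i).
Proof.
move=> [_ Y0 Ylin]; elim: N => [|N IHN] Yu; first by rewrite big_ord0.
rewrite big_ord_recr/= addrC -[u N]scale1r; apply: Ylin; first exact: Yu.
by apply: IHN => i iN; apply: Yu; exact: ltnW.
Qed.

Lemma closed_subspaceZ Y k x : closed_subspace Y -> Y x -> Y (k *: x).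
Proof. by move=> [_ Y0 Ylin] Yx; rewrite -[_ *: _]addr0; exact: Ylin. Qed.

Definition cspan (v : nat -> X) : set X := closure (linear_span v).

Lemma linear_span_pad (v : nat -> X) x : linear_span v x ->
  exists n, forall m, (n <= m)%N ->
  exists a : nat -> K, x = \sum_(i < m) a i *: v i.
Proof.
move=> [n [a ->]]; exists n => m nm.
exists (fun i => if (i < n)%N then a i else 0).
rewrite -(subnKC nm) big_split_ord/= [X in _ + X]big1 ?addr0.
  by apply: eq_bigr => i _; rewrite ltn_ord.
by move=> i _; rewrite ltnNge leq_addr scale0r.
Qed.

Lemma cspan_closed_subspace v : closed_subspace (cspan v).
Proof.
split.
- by have /closure_id <- := @closed_closure _ (linear_span v).
- by apply: subset_closure; exists 0, (fun=> 0); rewrite big_ord0.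
- move=> k x y xv yv; apply: approx_closure => eps eps0.
  (* Adding 1 keeps the divisor positive when [k] is zero. *)
  have k0 : 0 < `|k| + 1 by rewrite ltr_wpDl.
  have [x' x'v xx'] :=
    closure_approx xv (divr_gt0 (divr_gt0 eps0 (ltr0Sn _ 1)) k0).
  have [y' y'v yy'] := closure_approx yv (divr_gt0 eps0 (ltr0Sn _ 1)).
  exists (k *: x' + y').
    have [m1 x'E] := linear_span_pad x'v; have [m2 y'E] := linear_span_pad y'v.
    have [a ->] := x'E _ (leq_maxl m1 m2); have [b ->] := y'E _ (leq_maxr m1 m2).
    exists (maxn m1 m2), (fun i => k * a i + b i).
    rewrite scaler_sumr -big_split/=; apply: eq_bigr => i _.
    by rewrite scalerDl scalerA.
  rewrite opprD addrACA -scalerBr (le_lt_trans (ler_normD _ _))//.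
  rewrite [ltRHS]splitr ltr_leD// ?(ltW yy')// normrZ.
  rewrite (@le_lt_trans _ _ ((`|k| + 1) * `|x - x'|))//.
    by rewrite ler_wpM2r// lerDl.
  by rewrite mulrC -ltr_pdivlMr.
Qed.

Lemma cspan_min Y v : closed_subspace Y -> (forall n, Y (v n)) ->
  cspan v `<=` Y.
Proof.
move=> sY Yv; have [clY _ _] := sY.
apply: (subset_trans _ clY); apply: closure_subset => x [n [a ->]].
by apply: (@closed_subspace_sum _ n (fun i => a i *: v i)) => // i _;
  exact: closed_subspaceZ.
Qed.

Lemma mem_cspan v n : cspan v (v n).
Proof.
apply: subset_closure; exists n.+1, (fun i => (i == n)%:R).
rewrite big_ord_recr/= eqxx scale1r big1 ?add0r// => i _.
by rewrite (ltn_eqF (ltn_ord i)) scale0r.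
Qed.

(** A bounded additive functional is continuous, so its zero set is closed. Coordinate identities
    pass from a span to its closure in this way. *)
Lemma ker_closed (L : X -> K) (C : K) (A : set X) x : 0 < C ->
  (forall x y, L (x - y) = L x - L y) -> (forall x, `|L x| <= C * `|x|) ->
  closure A x -> (forall y, A y -> L y = 0) -> L x = 0.
Proof.
move=> C0 LB LC Ax LA; apply/eqP; apply: contrapT => /negP Lx.
have Lx0 : 0 < `|L x| by rewrite normr_gt0.
have [y Ay xy] := closure_approx Ax (divr_gt0 Lx0 C0).
have : `|L x| < `|L x|; last by rewrite ltxx.
have := LC (x - y); rewrite LB (LA _ Ay) subr0 => /le_lt_trans; apply.
by rewrite mulrC -ltr_pdivlMr.
Qed.

(** * Block sequences and their expansions *)

Definition block (v : nat -> X) : Prop :=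
  (forall n, v n != 0) /\ forall n, before e (v n) (v n.+1).

Lemma block_cspan v : block v -> block_subspace e (cspan v).
Proof. by move=> [v0 vb]; exists v. Qed.

Lemma block_subspaceP Y : block_subspace e Y -> exists2 v, block v & Y = cspan v.
Proof. by move=> [v [v0 vb ->]]; exists v. Qed.

Lemma block_before v i j : block v -> (i < j)%N -> before e (v i) (v j).
Proof.
move=> [v0 vb]; elim: j => // j IHj; rewrite ltnS leq_eqVlt => /predU1P[->//|ij].
by apply: before_trans (v0 j) _ (vb j); exact: IHj.
Qed.

Lemma block_shift v j : block v -> block (fun k => v (j + k)%N).
Proof.
by move=> [v0 vb]; split => n; [exact: v0|rewrite addnS; exact: vb].
Qed.

Lemma block_finsupp v n : block v -> exists N, finsupp N (v n).
Proof. by move=> [v0 vb]; exact: before_finsupp (v0 n.+1) (vb n). Qed.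

Lemma block_disjoint v i j n : block v ->
  coord (v i) n != 0 -> coord (v j) n != 0 -> i = j.
Proof.
move=> bv vi vj; case: (ltngtP i j) => // ij.
  by have /beforeE/(_ _ _ vi vj) := block_before bv ij; rewrite ltnn.
by have /beforeE/(_ _ _ vj vi) := block_before bv ij; rewrite ltnn.
Qed.

Lemma block_coord0 v k n : block v -> (n < k)%N -> coord (v k) n = 0.
Proof.
move=> bv; elim: k n => // k IHk n; rewrite ltnS => nk.
have [m vm] := coord_neq0 (bv.1 k).
apply/eqP; apply: contrapT => /negP vn.
have /beforeE/(_ _ _ vm vn) mn := bv.2 k.
by move: vm; rewrite IHk ?eqxx// (leq_trans mn).
Qed.

Lemma block_pivot v : block v -> exists t, forall k, coord (v k) (t k) != 0.
Proof.
move=> bv.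
by have [t] := choice (fun k => coord_neq0 (bv.1 k)); exists t.
Qed.

(* The coefficient of [v k] in an element [x] of the span is read off at a
   single coordinate [t k], because the supports are disjoint; as only the
   [v k] with [k <= n] reach the coordinate [n], the resulting formula is a
   finite one and passes to the closure. *)
Lemma cspan_coord v t x n : block v -> (forall k, coord (v k) (t k) != 0) ->
  cspan v x ->
  coord x n =
    \sum_(k < n.+1) coord x (t k) / coord (v k) (t k) * coord (v k) n.
Proof.
move=> bv vt vx; pose D k := coord (v k) n / coord (v k) (t k).
pose L (y : X) := coord y n - \sum_(k < n.+1) coord y (t k) * D k.
have LB y z : L (y - z) = L y - L z.
  rewrite /L coordB [in RHS]opprD opprK [RHS]addrACA; congr (_ + _).
  rewrite -[RHS]opprK opprD opprK -sumrB; congr (- _); apply: eq_bigr => i _.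
  by rewrite coordB mulrBl.
suff : L x = 0.
  move/eqP; rewrite /L subr_eq0 => /eqP ->; apply: eq_bigr => k _.
  by rewrite /D mulrA mulrAC.
apply: (@ker_closed _ (2 + \sum_(k < n.+1) 2 * `|D k|) (linear_span v)) => //.
- by rewrite ltr_wpDr// sumr_ge0// => i _; rewrite mulr_ge0.
- move=> y; rewrite /L (le_trans (ler_normB _ _))// mulrDl lerD ?coord_norm//.
  rewrite (le_trans (ler_norm_sum _ _ _))// mulr_suml ler_sum// => k _.
  by rewrite normrM mulrAC ler_wpM2r// coord_norm.
have vt0 j k : k != j -> coord (v j) (t k) = 0.
  move=> kj; apply/eqP; apply: contrapT => /negP vjk.
  by move/eqP: kj; apply; exact: block_disjoint (vt k) vjk.
have Lv j : L (v j) = 0.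
  (* For [j <= n] only the term [k = j] of the sum survives and it cancels; for [j > n] both parts
     of [L] vanish. *)
  rewrite /L; have [jn|nj] := ltnP j n.+1.
    rewrite (bigD1 (Ordinal jn))//= big1 ?addr0.
      by rewrite /D mulrC divfK ?subrr.
    by move=> k kj; rewrite vt0 ?mul0r.
  rewrite block_coord0// big1 ?subr0// => k _; rewrite vt0 ?mul0r//.
  by rewrite neq_ltn (leq_trans (ltn_ord k) nj).
move=> y [m [a ->]].
have L0 : L 0 = 0 by rewrite -(subrr 0) LB subrr.
have LD y1 z1 : L y1 = 0 -> L z1 = 0 -> L (y1 + z1) = 0.
  move=> y10 z10; have : L (y1 - (0 - z1)) = 0 by rewrite !LB y10 z10 L0 !subrr.
  by rewrite sub0r opprK.
elim: m => [|m IHm]; first by rewrite big_ord0.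
rewrite big_ord_recr/=; apply: LD => //.
have -> : L (a m *: v m) = a m * L (v m); last by rewrite Lv mulr0.
rewrite /L mulrBr coordZ; congr (_ - _).
by rewrite mulr_sumr; apply: eq_bigr => i _; rewrite coordZ -mulrA.
Qed.

(** Terms with [k >= N] drop out of the coordinate formula: the pivot [t k] is at least [k], hence
    outside the support of [x]. *)
Lemma cspan_sum v t N x : block v -> (forall k, coord (v k) (t k) != 0) ->
  cspan v x -> finsupp N x ->
  x = \sum_(k < N) (coord x (t k) / coord (v k) (t k)) *: v k.
Proof.
move=> bv vt vx Nx; apply: coord_inj => n; rewrite (cspan_coord n bv vt vx).
rewrite coord_sum; pose F k := coord x (t k) / coord (v k) (t k) * coord (v k) n.
transitivity (\sum_(k < maxn N n.+1) F k).
  rewrite (big_ord_widen _ F (leq_maxr N n.+1))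
    [RHS](bigID (fun k : 'I_(maxn N n.+1) => (k < n.+1)%N))/=.
  rewrite [X in _ + X]big1 ?addr0// => k; rewrite -leqNgt => nk.
  by rewrite /F [coord (v k) n]block_coord0 ?mulr0.
rewrite [RHS](eq_bigr (fun k : 'I_N => F k)); last by move=> k _; rewrite coordZ.
rewrite (big_ord_widen _ F (leq_maxl N n.+1))
  [LHS](bigID (fun k : 'I_(maxn N n.+1) => (k < N)%N))/=.
rewrite [X in _ + X]big1 ?addr0// => k; rewrite -leqNgt => Nk.
rewrite /F (Nx (t k)) ?mul0r// (leq_trans Nk)// leqNgt.
by apply: contra (vt k) => /(block_coord0 bv) ->.
Qed.

Lemma cspan_shift_sub v j : cspan (fun k => v (j + k)%N) `<=` cspan v.
Proof.
by apply: cspan_min; [exact: cspan_closed_subspace|move=> n; exact: mem_cspan].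
Qed.

(** A vector that comes after [v k] vanishes at the pivot [t k], so [v k] has coefficient zero in
    its expansion. *)
Lemma cspan_shift v j x N : block v -> cspan v x -> finsupp N x ->
  (forall k, (k < j)%N -> before e (v k) x) -> cspan (fun k => v (j + k)%N) x.
Proof.
move=> bv vx Nx jx; have [t vt] := block_pivot bv.
have cs := cspan_closed_subspace (fun k => v (j + k)%N).
rewrite (cspan_sum bv vt vx Nx).
apply: (closed_subspace_sum
  (u := fun k => (coord x (t k) / coord (v k) (t k)) *: v k) cs) => k _.
have [kj|jk] := ltnP k j; last first.
  apply: closed_subspaceZ cs _; rewrite -(subnKC jk).
  exact: (@mem_cspan (fun k => v (j + k)%N) (k - j)%N).
rewrite (_ : coord x (t k) = 0); first by rewrite mul0r scale0r; case: cs.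
apply/eqP; apply: contrapT => /negP xk.
by have /beforeE/(_ _ _ (vt k) xk) := jx _ kj; rewrite ltnn.
Qed.

Lemma coord0_closed_subspace M :
  closed_subspace [set x | forall n, (n < M)%N -> coord x n = 0].
Proof.
split => [x Ax n nM||k x y xM yM n nM] /=.
- apply: (@ker_closed (fun x => coord x n) 2 _ _ _ _ _ Ax) => //.
  + by move=> y z; exact: coordB.
  + by move=> y; exact: coord_norm.
  + by move=> y; apply.
- by move=> n _; exact: coord0.
- by rewrite coordD coordZ xM// yM// mulr0 addr0.
Qed.

Lemma block_subspace_tail Y M : block_subspace e Y -> exists Y',
  [/\ block_subspace e Y', Y' `<=` Y
    & forall x, Y' x -> forall n, (n < M)%N -> coord x n = 0].
Proof.
move=> /block_subspaceP[v bv ->]; exists (cspan (fun k => v (M + k)%N)); split.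
- exact/block_cspan/block_shift.
- exact: cspan_shift_sub.
- apply: (cspan_min (coord0_closed_subspace M)) => k n nM.
  by rewrite block_coord0// (leq_trans nM)// leq_addr.
Qed.

Lemma block_subspace_closed Y : block_subspace e Y -> closed_subspace Y.
Proof. by move=> [v [_ _ ->]]; exact: cspan_closed_subspace. Qed.

Lemma block_subspace_vector Y : block_subspace e Y ->
  exists x, [/\ Y x, x != 0 & exists N, finsupp N x].
Proof.
move=> /block_subspaceP[v bv ->]; exists (v 0%N); split; first exact: mem_cspan.
- exact: bv.1.
- exact: block_finsupp.
Qed.

(** * Block sequences with marked supports, and their tails *)

(** The marks [M] cut the coordinates into intervals: the support of [v j] lies in
    [[M j, M j.+1)]. *)
Definition enclosed (M : nat -> nat) (v : nat -> X) : Prop :=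
  forall j, finsupp (M j.+1) (v j) /\ forall n, (n < M j)%N -> coord (v j) n = 0.

Lemma enclosed_ltn M v j : block v -> enclosed M v -> (M j < M j.+1)%N.
Proof.
move=> bv Mv; have [n vn] := coord_neq0 (bv.1 j).
have [Mj1 Mj] := Mv j; apply: (@leq_ltn_trans n).
  by rewrite leqNgt; apply: contra vn => /Mj ->.
by rewrite ltnNge; apply: contra vn => /Mj1 ->.
Qed.

Lemma enclosed_leq M v i j : block v -> enclosed M v -> (i <= j)%N ->
  (M i <= M j)%N.
Proof.
move=> bv Mv; elim: j => [|j IHj]; first by rewrite leqn0 => /eqP ->.
rewrite leq_eqVlt => /predU1P[->//|/IHj ij].
by rewrite (leq_trans ij)// ltnW// (enclosed_ltn _ bv).
Qed.

Lemma enclosed_geq_id M v j : block v -> enclosed M v -> (j <= M j)%N.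
Proof.
by move=> bv Mv; elim: j => // j /leq_ltn_trans -> //; exact: (enclosed_ltn _ bv).
Qed.

Lemma enclosed_shift M v j : enclosed M v ->
  enclosed (fun k => M (j + k)%N) (fun k => v (j + k)%N).
Proof. by move=> Mv k; rewrite addnS; exact: Mv. Qed.

(** After its first [M j] vectors are dropped, a block sequence vanishes below [M j], hence comes
    after each [w i] with [i < j]. Statements about a tail of [w] thereby transfer to the whole
    span. *)
Lemma block_subspace_cut M w j V : block w -> enclosed M w ->
  block_subspace e V -> V `<=` cspan w ->
  exists V', [/\ block_subspace e V', V' `<=` V
    & V' `<=` cspan (fun k => w (j + k)%N)].
Proof.
move=> bw Mw /block_subspaceP[v bv ->] vw.
exists (cspan (fun k => v (M j + k)%N)); split.
- exact/block_cspan/block_shift.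
- exact: cspan_shift_sub.
- apply: cspan_min; first exact: cspan_closed_subspace.
  move=> k; have [N Nv] := block_finsupp (M j + k) bv.
  apply: (cspan_shift bw _ Nv); first exact/vw/mem_cspan.
  move=> i ij; have [wi _] := Mw i.
  apply: (finsupp_before (finsuppW (enclosed_leq bw Mw ij) wi)) => n nM.
  by rewrite block_coord0// (leq_trans nM)// leq_addr.
Qed.

(** Take [j = m.+1] with [w m] the last block occurring in [x]. The support of [w m] is contained in
    that of [x], so whatever follows [x] also follows [w m]. *)
Lemma cspan_next M w x : block w -> enclosed M w -> cspan w x -> x != 0 ->
  (exists N, finsupp N x) ->
  exists j, finsupp (M j) x /\ forall z, cspan w z -> (exists N, finsupp N z) ->
    before e x z -> cspan (fun k => w (j + k)%N) z.
Proof.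
move=> bw Mw wx x0 [N Nx]; have [t wt] := block_pivot bw.
pose b k := coord x (t k) / coord (w k) (t k).
have xE : x = \sum_(k < N) b k *: w k := cspan_sum bw wt wx Nx.
pose P k := (b k != 0) && (k < N)%N.
have exP : exists k, P k.
  apply: contrapT => /forallNP nP; move/eqP: x0; apply; rewrite xE big1// => k _.
  have [->|bk] := eqVneq (b k) 0; first exact: scale0r.
  by case: (nP k); rewrite /P bk/=.
have boundP k : P k -> (k <= N)%N by move=> /andP[_ /ltnW].
case: (ex_maxnP exP boundP) => m /andP[bm mN] maxm.
exists m.+1; split=> [n mn|z wz [N' Nz] xz].
  rewrite xE coord_sum big1// => k _; rewrite coordZ.
  have [->|bk] := eqVneq (b k) 0; first exact: mul0r.
  have km : (k <= m)%N by apply: maxm; rewrite /P bk/=.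
  by rewrite (Mw k).1 ?mulr0// (leq_trans _ mn)// (enclosed_leq bw).
have wmz : before e (w m) z.
  apply/beforeE => i j wi zj; have /beforeE := xz; apply => //.
  rewrite xE coord_sum (bigD1 (Ordinal mN))//= coordZ big1.
    by rewrite addr0; exact: mulf_neq0.
  move=> k km; rewrite coordZ (_ : coord (w k) i = 0) ?mulr0//.
  apply/eqP; apply: contrapT => /negP wk.
  by move/eqP: km; apply; apply/val_inj => /=; exact: block_disjoint wk wi.
apply: (cspan_shift bw wz Nz) => k; rewrite ltnS leq_eqVlt => /predU1P[->//|km].
exact: before_trans (bw.1 m) (block_before bw km) wmz.
Qed.

(** * Diagonalization over block subspaces *)

Definition hereditary (P : set X -> Prop) : Prop :=
  forall V V', block_subspace e V -> block_subspace e V' -> V' `<=` V ->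
  P V -> P V'.

Definition decided (P : set X -> Prop) (V : set X) : Prop :=
  P V \/ forall V', block_subspace e V' -> V' `<=` V -> ~ P V'.

Lemma decided_sub P V V' : hereditary P -> block_subspace e V ->
  block_subspace e V' -> V' `<=` V -> decided P V -> decided P V'.
Proof.
move=> hP bV bV' V'V [PV|nP]; first by left; exact: hP PV.
by right=> V'' bV'' V''V'; apply: nP => //; exact: subset_trans V'V.
Qed.

Lemma decide_seq (I : eqType) (Phi : I -> set X -> Prop) (s : seq I) V :
  (forall i, hereditary (Phi i)) -> block_subspace e V -> exists V',
  [/\ block_subspace e V', V' `<=` V & forall i, i \in s -> decided (Phi i) V'].
Proof.
move=> hPhi bV; elim: s => [|i s [V1 [bV1 V1V dV1]]]; first by exists V; split.
have [[V2 [bV2 V21 PV2]]|nP] := pselect (exists V2,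
    [/\ block_subspace e V2, V2 `<=` V1 & Phi i V2]).
  exists V2; split => //; first exact: subset_trans V1V.
  move=> k; rewrite inE => /predU1P[->|ks]; first by left.
  exact: decided_sub (dV1 _ ks).
exists V1; split => // k; rewrite inE => /predU1P[->|]; last exact: dV1.
by right => V' bV' V'1 PV'; apply: nP; exists V'.
Qed.

(** Once the vectors before [w j] are chosen, with supports below [M j], the finitely many
    conditions in [L (M j)] are decided by shrinking the current subspace. All later vectors are
    taken there, so the tail from [j] inherits the decisions. *)
Lemma fusion (I : eqType) (Phi : I -> set X -> Prop) (L : nat -> seq I) V :
  (forall i, hereditary (Phi i)) -> block_subspace e V ->
  exists w M, [/\ block w, enclosed M w, cspan w `<=` V &
    forall j i, i \in L (M j) -> decided (Phi i) (cspan (fun k => w (j + k)%N))].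
Proof.
move=> hPhi bV.
(* A stage consists of the subspace for all later choices and of a bound on the supports of the
   vectors already chosen. *)
pose inv (st : set X * nat) := [/\ block_subspace e st.1,
  forall x, st.1 x -> forall n, (n < st.2)%N -> coord x n = 0
  & forall i, i \in L st.2 -> decided (Phi i) st.1].
pose good st (y : X * (set X * nat)) := inv st ->
  [/\ inv y.2, y.2.1 `<=` st.1, st.1 y.1, y.1 != 0 & finsupp y.2.2 y.1].
have next st : exists y, good st y.
  have [ist|nist] := pselect (inv st); last by exists (0, st).
  have [bst _ _] := ist.
  have [x [xst x0 [N Nx]]] := block_subspace_vector bst.
  have [V1 [bV1 V1st V1N]] := block_subspace_tail N bst.
  have [V2 [bV2 V21 dV2]] := decide_seq (L N) hPhi bV1.
  exists (x, (V2, N)) => _; split => //; last exact: subset_trans V1st.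
  by split => // y V2y; exact/V1N/V21.
have [nx nxP] := choice next.
have [V0 [bV0 V0V dV0]] := decide_seq (L 0) hPhi bV.
pose st := fix st n := if n is m.+1 then (nx (st m)).2 else (V0, 0%N).
have st_inv n : inv (st n).
  by elim: n => [|n /nxP[]//]; split.
pose w n := (nx (st n)).1; pose M n := (st n).2.
have st_sub i j : (i <= j)%N -> (st j).1 `<=` (st i).1.
  elim: j => [|j IHj]; first by rewrite leqn0 => /eqP ->.
  rewrite leq_eqVlt => /predU1P[->//|/IHj]; apply: subset_trans.
  by have [] := nxP _ (st_inv j).
have stw j : (st j).1 (w j) by have [] := nxP _ (st_inv j).
have Mw : enclosed M w.
  move=> j; split=> [|n nM]; first by have [] := nxP _ (st_inv j).
  by have [_ + _] := st_inv j; apply.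
have bw : block w.
  split=> j; first by have [] := nxP _ (st_inv j).
  exact: finsupp_before (Mw j).1 (Mw j.+1).2.
have tail_sub j : cspan (fun k => w (j + k)%N) `<=` (st j).1.
  have [bst _ _] := st_inv j.
  apply: cspan_min; first exact: block_subspace_closed.
  by move=> k; apply: (st_sub j (j + k)%N); [exact: leq_addr|exact: stw].
exists w, M; split => //.
  by apply: subset_trans V0V; exact: (tail_sub 0%N).
move=> j i iL; have [bst _ /(_ _ iL) dst] := st_inv j.
apply: decided_sub (tail_sub j) dst => //.
exact/block_cspan/block_shift.
Qed.

(** * Finite nets and positions *)

Variables (R : realType) (scalarsK : real_or_complex R K).

Lemma combination_net M (eps : K) : 0 < eps ->
  exists s : seq X, forall a : nat -> K, (forall i, `|a i| <= 2) ->
    exists2 d, d \in s & `|\sum_(i < M) a i *: e i - d| <= eps.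
Proof.
elim: M eps => [|M IHM] eps eps0.
  exists [:: 0] => a _; exists 0; first by rewrite mem_seq1.
  by rewrite big_ord0 subrr normr0 ltW.
have [s sP] := IHM _ (divr_gt0 eps0 (ltr0Sn K 1)).
have [t tP] := scalar_net scalarsK (divr_gt0 eps0 (ltr0Sn K 1)).
exists [seq d + g *: e M | d <- s, g <- t] => a a2.
have [d ds ad] := sP a a2; have [g gt ag] := tP _ (a2 M).
exists (d + g *: e M); first exact: allpairs_f.
rewrite big_ord_recr/= opprD addrACA -scalerBl.
rewrite (le_trans (ler_normD _ _))// [leRHS]splitr lerD//.
by rewrite normrZ normalized_e mulr1.
Qed.

Lemma pair_net M (eps : K) : 0 < eps ->
  exists s : seq (X * K), forall u, sphere_itv u -> finsupp M u.1 ->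
    exists2 d, d \in s & pair_dist u d <= eps.
Proof.
move=> eps0.
have [s sP] := combination_net M (divr_gt0 eps0 (ltr0Sn K 1)).
have [t tP] := scalar_net scalarsK (divr_gt0 eps0 (ltr0Sn K 1)).
exists [seq (d, g) | d <- s, g <- t] => u [u1 /andP[u20 u21]] Mu.
have [|d ds ud] := sP (coord u.1).
  by move=> i; rewrite (le_trans (coord_norm _ _))// u1 mulr1.
have [|g gt ug] := tP u.2; first by rewrite ger0_norm// (le_trans u21)// ler1n.
exists (d, g); first exact: allpairs_f.
by rewrite /pair_dist/= [leRHS]splitr lerD// [in `|u.1 - _|](finsupp_sum Mu).
Qed.

(** The approximation of [u] must not depend on [M], yet lie in [A i M] for every [M] that bounds
    the support. It is therefore taken from the net of the least such bound, and [A i M] collects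
    the nets of all [m <= M]. *)
Lemma approximation (eta : nat -> K) : (forall i, 0 < eta i) ->
  exists (ap : nat -> X * K -> X * K) (A : nat -> nat -> seq (X * K)),
    (forall i M N, (M <= N)%N -> {subset A i M <= A i N}) /\
    forall i u, sphere_itv u -> (exists N, finsupp N u.1) ->
      pair_dist u (ap i u) <= eta i /\
      forall M, finsupp M u.1 -> ap i u \in A i M.
Proof.
move=> eta0; have [net netP] :=
  choice (fun iM : nat * nat => pair_net iM.2 (eta0 iM.1)).
pose A i M := flatten [seq net (i, m) | m <- iota 0 M.+1].
have memA i M d : reflect (exists2 m, (m <= M)%N & d \in net (i, m)) (d \in A i M).
  apply: (iffP flatten_mapP) => -[m mM dm]; exists m => //.
    by move: mM; rewrite mem_iota.
  by rewrite mem_iota.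
have appr (iu : nat * (X * K)) : exists d, sphere_itv iu.2 ->
    (exists N, finsupp N iu.2.1) -> pair_dist iu.2 d <= eta iu.1 /\
      forall M, finsupp M iu.2.1 -> d \in A iu.1 M.
  case: iu => i u /=.
  have [[su [N Nu]]|nu] :=
      pselect (sphere_itv u /\ exists N, finsupp N u.1); last first.
    by exists (0, 0) => su fu; case: nu.
  have exN : exists n, `[< finsupp n u.1 >] by exists N; apply/asboolP.
  case: (ex_minnP exN) => m /asboolP mu minm.
  have [d dm ud] := netP (i, m) u su mu.
  exists d => _ _; split => // M Mu; apply/memA; exists m => //.
  by apply: minm; apply/asboolP.
have [ap apP] := choice appr.
exists (fun i u => ap (i, u)), A; split=> [i M N MN d /memA[m mM dm]|i u su fu].
  by apply/memA; exists m => //; exact: leq_trans MN.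
exact: (apP (i, u)).
Qed.

Section Positions.
Variables (A : nat -> nat -> seq (X * K)).
Hypothesis subA : forall i M N, (M <= N)%N -> {subset A i M <= A i N}.

Fixpoint words (k M : nat) : seq (seq (X * K)) :=
  if k is k'.+1 then [seq rcons p d | p <- words k' M, d <- A k' M]
  else [:: [::]].

(** This finite list covers the positions produced by moves supported below [M]: at most [M]
    successive nonzero vectors fit there. *)
Definition positions (M : nat) : seq (seq (X * K)) :=
  flatten [seq words k M | k <- iota 0 M.+1].

Lemma words_nth k M p : p \in words k M <->
  size p = k /\ forall i, (i < k)%N -> nth (0, 0) p i \in A i M.
Proof.
elim: k p => [|k IHk] p /=.
  by rewrite mem_seq1; split=> [/eqP ->|[/size0nil -> _]].
split=> [/allpairsP[[q d] /= [/IHk[sq qA] dA ->]]|].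
  split=> [|i]; first by rewrite size_rcons sq.
  rewrite ltnS leq_eqVlt nth_rcons sq => /predU1P[->|ik].
    by rewrite ltnn eqxx.
  by rewrite ik; exact: qA.
case/lastP: p => [[]//|p d] [/eqP]; rewrite size_rcons eqSS => /eqP sp pA.
apply: allpairs_f.
  apply/IHk; split => // i ik.
  by have := pA i (ltnW ik); rewrite nth_rcons sp ik.
by have := pA k (leqnn _); rewrite nth_rcons sp ltnn eqxx.
Qed.

Lemma positionsP M p : p \in positions M <->
  (size p <= M)%N /\ forall i, (i < size p)%N -> nth (0, 0) p i \in A i M.
Proof.
split=> [/flatten_mapP[k + /words_nth[-> pA]]|[pM pA]].
  by rewrite mem_iota.
apply/flatten_mapP; exists (size p); first by rewrite mem_iota.
exact/words_nth.
Qed.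

Lemma positions_sub M N : (M <= N)%N -> {subset positions M <= positions N}.
Proof.
move=> MN p /positionsP[pM pA]; apply/positionsP.
by split=> [|i /pA]; [exact: leq_trans MN|exact: subA].
Qed.

Lemma positions_rcons M N p d : p \in positions M -> (M <= N)%N ->
  (size p < N)%N -> d \in A (size p) N -> rcons p d \in positions N.
Proof.
move=> pM MN pN dN; apply/positionsP; rewrite size_rcons; split=> // i.
rewrite ltnS leq_eqVlt nth_rcons => /predU1P[->|ip]; first by rewrite ltnn eqxx.
by rewrite ip; apply: subA MN _ _; have /positionsP[_] := pM; apply.
Qed.

(** Words [s] enter by their code, which must be below [M]: each list is finite and every word
    appears eventually. *)
Definition indices (M : nat) : seq (seq (X * K) * seq nat) :=
  [seq (p, s) | p <- positions M, s <- pmap unpickle (iota 0 M)].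

Lemma indicesP M p s : p \in positions M -> (pickle s < M)%N ->
  (p, s) \in indices M.
Proof.
move=> pM sM; apply: allpairs_f => //.
by rewrite mem_pmap; apply/mapP; exists (pickle s); rewrite ?pickleK ?mem_iota.
Qed.


(** * The finite games *)

Variables (eta : nat -> K) (ap : nat -> X * K -> X * K).
Hypothesis apP : forall i u, sphere_itv u -> (exists N, finsupp N u.1) ->
  pair_dist u (ap i u) <= eta i /\ forall M, finsupp M u.1 -> ap i u \in A i M.

Definition extend (p : seq (X * K)) (u : X * K) : seq (X * K) :=
  rcons p (ap (size p) u).

Definition legal (u : X * K) (V : set X) : Prop :=
  [/\ sphere_itv u, V u.1 & exists N, finsupp N u.1].

Lemma legal_sub u V V' : V' `<=` V -> legal u V' -> legal u V.
Proof. by move=> V'V [su Vu fu]; split => //; exact: V'V. Qed.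

Lemma sphere_itv_neq0 (u : X * K) : sphere_itv u -> u.1 != 0.
Proof. by move=> [u1 _]; rewrite -normr_eq0 u1 oner_eq0. Qed.

Lemma Sigma_block w : Sigma e w -> block (fun i => (w i).1).
Proof. by move=> [sw bw]; split => // i; exact/sphere_itv_neq0/sw. Qed.

Lemma Sigma_ltn w i M : Sigma e w -> finsupp M (w i).1 -> (i < M)%N.
Proof.
move=> /Sigma_block bw Mw; have [n wn] := coord_neq0 (bw.1 i).
apply: (@leq_ltn_trans n).
  by rewrite leqNgt; apply: contra wn => /(block_coord0 bw) ->.
by rewrite ltnNge; apply: contra wn => /Mw ->.
Qed.

Lemma Sigma_finsupp w i j M : Sigma e w -> finsupp M (w j).1 -> (i <= j)%N ->
  finsupp M (w i).1.
Proof.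
move=> /Sigma_block bw Mw; rewrite leq_eqVlt => /predU1P[->//|ij].
exact: before_finsuppl (bw.1 j) (block_before bw ij) Mw.
Qed.

Section FiniteGame.
Variable T : seq (X * K) -> Prop.

(* A strategy for P in the game that P wins by reaching [T] in finitely many
   moves. *)
Inductive tree : Type :=
  Leaf | Node of (set X -> X * K) & (set X -> tree).

Fixpoint winning_tree (V : set X) (t : tree) (p : seq (X * K)) : Prop :=
  match t with
  | Leaf => T p
  | Node mv nx => forall V', block_subspace e V' -> V' `<=` V ->
      legal (mv V') V' /\ winning_tree V (nx V') (extend p (mv V'))
  end.

(** The root is a [Node]: P makes at least one move, so a finite game begun right after another has
    a move to offer. *)
Definition reachable (V : set X) (p : seq (X * K)) : Prop :=
  exists mv nx, winning_tree V (Node mv nx) p.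

Lemma reachable_step V p :
  (forall V', block_subspace e V' -> V' `<=` V -> exists u,
    legal u V' /\ (T (extend p u) \/ reachable V (extend p u))) ->
  reachable V p.
Proof.
move=> step.
have next V' : exists y : (X * K) * tree, block_subspace e V' -> V' `<=` V ->
    legal y.1 V' /\ winning_tree V y.2 (extend p y.1).
  have [[bV' V'V]|nV'] := pselect (block_subspace e V' /\ V' `<=` V); last first.
    by exists ((0, 0), Leaf) => bV' V'V; case: nV'.
  have [u [lu [Tu|[mv [nx ok]]]]] := step V' bV' V'V.
    by exists (u, Leaf).
  by exists (u, Node mv nx).
have [g gP] := choice next.
by exists (fun V' => (g V').1), (fun V' => (g V').2) => V'; exact: gP.
Qed.

(** P pretends that S chose the smaller [h V'], contained in [V1]; the answers remain legal in
    [V']. *)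
Lemma reachable_dense V1 V2 p :
  (forall V', block_subspace e V' -> V' `<=` V2 -> exists V'',
    [/\ block_subspace e V'', V'' `<=` V' & V'' `<=` V1]) ->
  reachable V1 p -> reachable V2 p.
Proof.
move=> dense.
have next V' : exists V'', block_subspace e V' -> V' `<=` V2 ->
    [/\ block_subspace e V'', V'' `<=` V' & V'' `<=` V1].
  have [[bV' V'V]|nV'] := pselect (block_subspace e V' /\ V' `<=` V2).
    by have [V'' ?] := dense V' bV' V'V; exists V''.
  by exists set0 => bV' V'V; case: nV'.
have [h hP] := choice next.
pose fix remap t := if t is Node mv nx then
  Node (fun V' => mv (h V')) (fun V' => remap (nx (h V'))) else Leaf.
have remapP t q : winning_tree V1 t q -> winning_tree V2 (remap t) q.
  elim: t q => [//|mv nx IHnx] q /= ok V' bV' V'V.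
  have [bh hV' hV1] := hP V' bV' V'V; have [lh okh] := ok _ bh hV1.
  by split; [exact: legal_sub hV' lh|exact: IHnx].
move=> [mv [nx ok]].
by exists (fun V' => mv (h V')), (fun V' => remap (nx (h V')));
  exact: (remapP (Node mv nx)).
Qed.

Lemma reachable_sub V1 V2 p : V2 `<=` V1 -> reachable V1 p -> reachable V2 p.
Proof.
move=> V21; apply: reachable_dense => V' bV' V'V2.
by exists V'; split => //; exact: subset_trans V21.
Qed.

(** Winning in the tail would mean winning in the whole span, so the decision on the tail is
    negative. A [V] where P wins could be cut down into that tail. *)
Lemma unreachable_decided M w p j : block w -> enclosed M w ->
  decided (reachable^~ p) (cspan (fun k => w (j + k)%N)) ->
  ~ reachable (cspan w) p ->
  forall V, block_subspace e V -> V `<=` cspan w -> ~ reachable V p.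
Proof.
move=> bw Mw dp nw V bV Vw Vp.
have [Wp|nW] := dp.
  apply: nw; apply: reachable_dense Wp => V' bV' V'w.
  exact: block_subspace_cut bw Mw bV' V'w.
have [V' [bV' V'V V'w]] := block_subspace_cut j bw Mw bV Vw.
exact: nW bV' V'w (reachable_sub V'V Vp).
Qed.

Lemma avoiding_subspace W p m : block_subspace e W ->
  (forall q M V, q \in positions M -> ~ reachable W q -> block_subspace e V ->
    V `<=` W -> ~ reachable V q) ->
  p \in positions m -> ~ reachable W p ->
  exists U, [/\ block_subspace e U, U `<=` W & forall w, Sigma e w ->
    (forall i, (size p <= i)%N -> U (w i).1) -> forall q,
    (forall n, q n.+1 = extend (q n) (w (size p + n)%N)) -> q 0%N = p ->
    forall n, ~ T (q n.+1)].
Proof.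
move=> bW stay pm np.
(* [Psi q V]: no legal move in [V] leads from [q] to the target or to a reachable position. *)
pose Psi q V := forall u, legal u V ->
  ~ T (extend q u) /\ ~ reachable W (extend q u).
have hPsi q : hereditary (Psi q).
  by move=> V V' _ _ V'V PV u /(legal_sub V'V); exact: PV.
have [v [M [bv Mv vW dv]]] := fusion positions hPsi bW.
have tailW j : cspan (fun k => v (j + k)%N) `<=` W.
  by apply: subset_trans vW; exact: cspan_shift_sub.
have Psi_tail q j : q \in positions (M j) -> ~ reachable W q ->
    Psi q (cspan (fun k => v (j + k)%N)).
  move=> qj nq; have [//|nPsi] := dv j q qj.
  have bt := block_cspan (block_shift j bv).
  (* If [Psi q] held on no block subspace of the tail, each would offer P a good move, making [q]
     reachable in the tail, against [stay]. *)
  case: (stay _ _ _ qj nq bt (tailW j)).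
  apply: reachable_step => V' bV' V't; apply: contrapT => nV'.
  apply: (nPsi V' bV' V't) => u lu; split => [Tu|ru]; apply: nV'; exists u.
    by split => //; left.
  by split => //; right; exact: reachable_sub (tailW j) ru.
(* Since [m <= M m], the starting position [p] is already decided on this tail. *)
exists (cspan (fun k => v (m + k)%N)); split => //.
  exact/block_cspan/block_shift.
move=> w sw wU q qS q0.
have szq n : size (q n) = (size p + n)%N.
  by elim: n => [|n IHn]; rewrite ?q0 ?addn0// qS size_rcons IHn addnS.
have sw1 i := sw.1 i.
have fw i : exists N, finsupp N (w i).1.
  exact: block_finsupp (Sigma_block sw).
(* Invariant: the position is unreachable, and it is decided on a tail that contains all remaining
   vectors of [w]. *)
have main n : ~ reachable W (q n) /\ exists j, q n \in positions (M j) /\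
    forall i, (size p + n <= i)%N -> cspan (fun k => v (j + k)%N) (w i).1.
  elim: n => [|n [nqn [j [qj wj]]]].
    rewrite q0 addn0; split => //; exists m; split => //.
    by apply: positions_sub pm; exact: (enclosed_geq_id _ bv).
  have lw : legal (w (size p + n)%N) (cspan (fun k => v (j + k)%N)).
    by split => //; exact: wj.
  rewrite qS; split; first by have [] := Psi_tail _ _ qj nqn _ lw.
  have w0 := sphere_itv_neq0 (sw1 (size p + n)%N).
  have [k [wk wnext]] := cspan_next (block_shift j bv) (enclosed_shift j Mv)
    (wj _ (leqnn _)) w0 (fw _).
  exists (j + k)%N; split => [|i].
    apply: positions_rcons qj _ _ _.
    - by apply: (enclosed_leq bv Mv); exact: leq_addr.
    - by rewrite szq; exact: Sigma_ltn sw wk.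
    - rewrite szq; have [_] := apP (size p + n)%N (sw1 _) (fw (size p + n)%N).
      exact.
  rewrite addnS => ni; rewrite (_ : (fun l => v (j + k + l)%N) =
      (fun l => v (j + (k + l))%N)); last by apply/funext => l; rewrite addnA.
  apply: wnext => //; first by apply: wj; exact: ltnW.
  exact: block_before (Sigma_block sw) ni.
move=> n; rewrite qS; have [nqn [j [qj wj]]] := main n.
have [|//] := Psi_tail _ _ qj nqn (w (size p + n)%N).
by split => //; exact: wj.
Qed.

End FiniteGame.

(** * Large positions *)

Section Large.
Variable F : (nat -> nat) -> nat -> X * K.
Hypothesis SigmaF : forall b, Sigma e (F b).

Definition near_play (p : seq (X * K)) (w : nat -> X * K) : Prop :=
  forall i, (i < size p)%N -> pair_dist (w i) (nth (0, 0) p i) <= eta i.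

Definition agree (s : seq nat) (b : nat -> nat) : Prop :=
  forall i, (i < size s)%N -> b i = nth 0%N s i.

(** The terms that [p] approximates may lie outside [V]; the later ones must lie in it. *)
Definition witness (p : seq (X * K)) (s : seq nat) (V : set X)
    (b : nat -> nat) : Prop :=
  [/\ agree s b, near_play p (F b) &
      forall i, (size p <= i)%N -> V (F b i).1].

Definition large_at (W : set X) (p : seq (X * K)) (s : seq nat) : Prop :=
  forall V, block_subspace e V -> V `<=` W -> exists b, witness p s V b.

Lemma witness_sub p s V V' b : V' `<=` V -> witness p s V' b -> witness p s V b.
Proof. by move=> V'V [sb pb Vb]; split => // i /Vb; exact: V'V. Qed.

Lemma near_play_extend p w N : size p = N -> sphere_itv (w N) ->
  (exists M, finsupp M (w N).1) -> near_play p w -> near_play (extend p (w N)) w.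
Proof.
move=> pN sw fw pw i; rewrite /extend size_rcons ltnS leq_eqVlt nth_rcons.
case/predU1P => [->|ip]; last by rewrite ip; exact: pw.
by rewrite ltnn eqxx pN; have [] := apP N sw fw.
Qed.

(* In [W], a single witness makes a position large, provided the position is
   long compared to [s]. *)
Lemma coherent_subspace V : block_subspace e V -> exists W,
  [/\ block_subspace e W, W `<=` V &
    forall p s b n, size p = n.+1 -> (pickle s <= n)%N -> agree s b ->
      near_play p (F b) -> (forall i, (n <= i)%N -> W (F b i).1) ->
      (forall M, finsupp M (F b n).1 -> p \in positions M) ->
      large_at W p s].
Proof.
move=> bV.
(* Having no witness is the form of the condition that passes to smaller subspaces. *)
pose Phi (ps : seq (X * K) * seq nat) U := ~ exists b, witness ps.1 ps.2 U b.
have hPhi ps : hereditary (Phi ps).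
  by move=> U U' _ _ U'U nU [b wb]; apply: nU; exists b; exact: witness_sub wb.
have [w [M [bw Mw wV dw]]] := fusion indices hPhi bV.
exists (cspan w); split => //; first exact: block_cspan.
move=> p s b n pn sn sb pb Wb pM.
have bF := Sigma_block (SigmaF b).
have fF i : exists N, finsupp N (F b i).1 by exact: block_finsupp bF.
have [j [Mj next]] := cspan_next bw Mw (Wb _ (leqnn n)) (bF.1 n) (fF n).
(* The vector of index [n] has support below [M j], so [n < M j] and [(p, s)] is decided on this
   tail. The witness [b] then rules out [Phi] there. *)
have [nsm|lsm] := dw j (p, s) (indicesP (pM _ Mj)
    (leq_ltn_trans sn (Sigma_ltn (SigmaF b) Mj))).
  case: nsm; exists b; split => //= i; rewrite pn => ni.
  by apply: next => //; [apply: Wb; exact: ltnW|exact: block_before bF ni].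
move=> V' bV' V'w.
have [V'' [bV'' V''V' V''w]] := block_subspace_cut j bw Mw bV' V'w.
have /contrapT[c wc] := lsm V'' bV'' V''w.
by exists c; exact: witness_sub wc.
Qed.

(** [L] is largeness in [W], kept fixed while a second fusion produces [Y] inside [W], where
    reachability is decided. *)
Lemma large_reachable V :
  block_subspace e V -> large_at V [::] [::] -> exists Y L,
  [/\ block_subspace e Y, L [::] [::],
    forall p s, L p s -> exists2 b, agree s b & near_play p (F b) &
    forall m p s, p \in positions m -> L p s ->
      reachable (fun q => exists k, L q (rcons s k)) Y p].
Proof.
move=> bV LV; have [W [bW WV cohW]] := coherent_subspace bV.
pose T s q := exists k, large_at W q (rcons s k).
pose Phi (ps : seq (X * K) * seq nat) U := reachable (T ps.2) U ps.1.
have hPhi ps : hereditary (Phi ps).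
  by move=> U U' _ _ U'U; exact: reachable_sub.
have [w [M [bw Mw wW dw]]] := fusion indices hPhi bW.
exists (cspan w), (large_at W); split; first exact: block_cspan.
- by move=> U bU UW; apply: LV => //; exact: subset_trans WV.
- by move=> p s Lps; have [b [sb pb _]] := Lps W bW (@subset_refl _ _); exists b.
move=> m p s pm Lps; apply: contrapT => np.
have stay q N U : q \in positions N -> ~ reachable (T s) (cspan w) q ->
    block_subspace e U -> U `<=` cspan w -> ~ reachable (T s) U q.
  move=> qN nq; pose j := maxn N (pickle s).+1.
  apply: (unreachable_decided bw Mw _ nq (j := j)).
  apply: (dw j (q, s)); apply: indicesP.
    apply: positions_sub qN; apply: (@leq_trans j); first exact: leq_maxl.
    exact: enclosed_geq_id Mw.
  by apply: (@leq_trans j); [exact: leq_maxr|exact: enclosed_geq_id Mw].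
have [U [bU Uw avoid]] := avoiding_subspace (block_cspan bw) stay pm np.
have UW := subset_trans Uw wW.
(* Largeness of [(p, s)] puts a continuation into the very subspace where the target should be
   unattainable. *)
have [b [sb pb Ub]] := Lps U bU UW.
pose q := fix q n := if n is k.+1 then extend (q k) (F b (size p + k)%N) else p.
have sF := SigmaF b; have bF := Sigma_block sF.
have fF i : exists N, finsupp N (F b i).1 by exact: block_finsupp bF.
have szq n : size (q n) = (size p + n)%N.
  by elim: n => [|n IHn]; rewrite ?addn0//= size_rcons IHn addnS.
have nearq n : near_play (q n) (F b).
  elim: n => [//|n IHn] /=.
  by apply: near_play_extend; [exact: szq|exact: sF.1|exact: fF|].
(* P waits until the position is long compared to the code of [s'], as [cohW] requires; the maximum
   with [m] ensures [p \in positions N] below. *)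
pose s' := rcons s (b (size s)); pose n := maxn m (pickle s').
apply: (avoid (F b) sF Ub q _ _ n) => //.
exists (b (size s)); apply: (cohW _ _ b (size p + n)%N) => //.
- by rewrite szq addnS.
- exact: leq_trans (leq_maxr m _) (leq_addl _ _).
- move=> i; rewrite size_rcons ltnS leq_eqVlt nth_rcons => /predU1P[->|si].
    by rewrite ltnn eqxx.
  by rewrite si; exact: sb.
- by move=> i ni; apply/UW/Ub; exact: leq_trans (leq_addr _ _) ni.
move=> N Nb; have nN := Sigma_ltn sF Nb.
have mN : (m <= N)%N.
  exact: leq_trans (leq_maxl m _) (leq_trans (leq_addl _ _) (ltnW nN)).
suff qN k : (k <= n.+1)%N -> q k \in positions N by exact: qN.
elim: k => [_|k IHk kn]; first exact: positions_sub pm.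
have kN : (size p + k <= size p + n)%N by rewrite leq_add2l -ltnS.
apply: positions_rcons (IHk (ltnW kn)) (leqnn N) _ _.
  by rewrite szq (leq_ltn_trans kN).
rewrite szq; have [_] := apP (size p + k)%N (sF.1 _) (fF (size p + k)%N).
by apply; exact: Sigma_finsupp sF Nb kN.
Qed.

End Large.

(** * Strategies in the infinite game *)

(* A strategy only sees P's own moves, while the state [st] of a machine also
   depends on the subspaces chosen by S. From P's moves alone one reconstructs
   some subspaces that would have led to them, and the machine wins against
   these as well. *)
Lemma strategy_of_machine (St : Type) (st0 : St)
    (step : St -> set X -> (X * K) * St) (inv : St -> Prop)
    (Y : set X) (target : set (nat -> X * K)) :
  inv st0 ->
  (forall st V, inv st -> block_subspace e V -> V `<=` Y ->
    [/\ sphere_itv (step st V).1, V (step st V).1.1 & inv (step st V).2]) ->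
  (forall (st : nat -> St) (Z : nat -> set X), st 0%N = st0 ->
    (forall n, block_subspace e (Z n) /\ Z n `<=` Y) ->
    (forall n, st n.+1 = (step (st n) (Z n)).2) ->
    target (fun n => (step (st n) (Z n)).1)) ->
  strategically_large e target Y.
Proof.
move=> inv0 step_inv step_target.
pose compatible st u :=
  [set V | [/\ block_subspace e V, V `<=` Y & (step st V).1 = u]].
pose guess st u := xget set0 (compatible st u).
pose state h := foldl (fun st u => (step st (guess st u)).2) st0 h.
pose str : strategy X := fun h V => (step (state h) V).1.
exists str => Z ZY.
pose st n := state (history str Z n).
have guessP n : compatible (st n) (play str Z n) (guess (st n) (play str Z n)).
  by apply: xgetPex; exists (Z n); have [bZ ZnY] := ZY n; split.
have stS n : st n.+1 = (step (st n) (guess (st n) (play str Z n))).2.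
  by rewrite /st /state /= foldl_rcons.
have inv_st n : inv (st n).
  elim: n => [//|n IHn]; rewrite stS; have [bV VY _] := guessP n.
  by have [] := step_inv _ _ IHn bV VY.
split=> [n|].
  by have [bZ ZnY] := ZY n; have [] := step_inv _ _ (inv_st n) bZ ZnY.
have -> : play str Z = fun n => (step (st n) (guess (st n) (play str Z n))).1.
  by apply/funext => n; have [_ _ ->] := guessP n.
apply: step_target => // n; by have [bV VY _] := guessP n.
Qed.

Section Composition.
Variables (Y : set X) (L : seq (X * K) -> seq nat -> Prop).
Hypothesis Lreach : forall m p s, p \in positions m -> L p s ->
  reachable (fun q => exists k, L q (rcons s k)) Y p.

(** The first two fields form the root of the winning tree of the finite game in progress; [bound]
    bounds the support of the last move. *)
Record state := State {
  moves : set X -> X * K;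
  continuation : set X -> tree;
  word : seq nat;
  position : seq (X * K);
  bound : nat }.

Definition consistent (st : state) : Prop :=
  winning_tree (fun q => exists k, L q (rcons (word st) k)) Y
    (Node (moves st) (continuation st)) (position st) /\
  exists m, position st \in positions m.

(* When P has won the current finite game, a letter is appended to [word] and
   the next finite game is started. *)
Lemma composition : L [::] [::] -> strategically_large e
  [set u | Sigma e u /\ exists (p : nat -> seq (X * K)) (s : nat -> seq nat),
    [/\ p 0%N = [::], forall n, p n.+1 = extend (p n) (u n),
      forall n, exists t, s n.+1 = s n ++ t
    & forall m, exists n, [/\ (m <= n)%N, (m <= size (s n))%N & L (p n) (s n)]]]
  Y.
Proof.
move=> L0.
have start_ex (ps : seq (X * K) * seq nat) :
    exists y : (set X -> X * K) * (set X -> tree),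
    L ps.1 ps.2 -> (exists m, ps.1 \in positions m) ->
    winning_tree (fun q => exists k, L q (rcons ps.2 k)) Y (Node y.1 y.2) ps.1.
  have [[Lps [m pm]]|nps] :=
      pselect (L ps.1 ps.2 /\ exists m, ps.1 \in positions m).
    by have [mv [nx ok]] := Lreach pm Lps; exists (mv, nx).
  by exists (fun=> (0, 0), fun=> Leaf) => Lps pm; case: nps.
have letter_ex (ps : seq (X * K) * seq nat) : exists k,
    (exists k', L ps.1 (rcons ps.2 k')) -> L ps.1 (rcons ps.2 k).
  have [[k Lk]|nk] := pselect (exists k', L ps.1 (rcons ps.2 k')).
    by exists k.
  by exists 0%N => Lk; case: nk.
(* P answers inside the part of the given subspace that lies beyond [bound], so his moves have
   successive supports. *)
have cut_ex (VM : set X * nat) : exists V', block_subspace e VM.1 ->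
    [/\ block_subspace e V', V' `<=` VM.1
      & forall x, V' x -> forall n, (n < VM.2)%N -> coord x n = 0].
  have [bV|nV] := pselect (block_subspace e VM.1).
    by have [V' ?] := block_subspace_tail VM.2 bV; exists V'.
  by exists set0 => bV; case: nV.
have size_ex (u : X * K) : exists N, (exists N, finsupp N u.1) -> finsupp N u.1.
  have [[N Nu]|nu] := pselect (exists N, finsupp N u.1); first by exists N.
  by exists 0%N => fu; case: nu.
have [start startP] := choice start_ex.
have [letter letterP] := choice letter_ex.
have [cut cutP] := choice cut_ex; have [supp_size sizeP] := choice size_ex.
pose advance p s N t := if t is Node mv nx then State mv nx s p N else
  let s' := rcons s (letter (p, s)) in
  State (start (p, s')).1 (start (p, s')).2 s' p N.
pose reply st V := moves st (cut (V, bound st)).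
pose next st V := advance (extend (position st) (reply st V)) (word st)
  (supp_size (reply st V)) (continuation st (cut (V, bound st))).
pose st0 := State (start ([::], [::])).1 (start ([::], [::])).2 [::] [::] 0.
have pos0 : [::] \in positions 0 by apply/positionsP.
have st0_cons : consistent st0.
  by split; [apply: (startP ([::], [::])) => //|]; exists 0%N.
have advance_cons p s N t m : p \in positions m ->
    winning_tree (fun q => exists k, L q (rcons s k)) Y t p ->
    consistent (advance p s N t).
  case: t => [|mv nx] pm tp; split; try by exists m.
    apply: (startP (p, rcons s (letter (p, s)))); last by exists m.
    exact: (letterP (p, s)).
  exact: tp.
have reply_legal st V : consistent st -> block_subspace e V -> V `<=` Y ->
    legal (reply st V) (cut (V, bound st)) /\
    winning_tree (fun q => exists k, L q (rcons (word st) k)) Y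
      (continuation st (cut (V, bound st))) (extend (position st) (reply st V)).
  move=> [ok _] bV VY; have [bV' V'V _] := cutP (V, bound st) bV.
  by apply: ok => //; exact: subset_trans VY.
have next_cons st V : consistent st -> block_subspace e V -> V `<=` Y ->
    consistent (next st V).
  move=> cst bV VY; have [[su _ fu] ok] := reply_legal _ _ cst bV VY.
  have [_ [m pm]] := cst; have [N Nu] := fu.
  pose k := maxn m (maxn (size (position st)).+1 N).
  apply: (advance_cons _ _ _ _ k) ok; apply: positions_rcons pm _ _ _.
  - exact: leq_maxl.
  - exact: leq_trans (leq_maxl _ N) (leq_maxr m _).
  - have [_] := apP (size (position st)) su fu; apply; apply: finsuppW Nu.
    exact: leq_trans (leq_maxr _ _) (leq_maxr m _).
have next_position st V :
    position (next st V) = extend (position st) (reply st V).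
  by rewrite /next /advance; case: continuation.
have next_bound st V : bound (next st V) = supp_size (reply st V).
  by rewrite /next /advance; case: continuation.
apply: (@strategy_of_machine _ st0 (fun st V => (reply st V, next st V))
  consistent) => //= [st V cst bV VY|st Z sts ZY stS].
  have [[su Vu _] _] := reply_legal _ _ cst bV VY.
  split=> //; last exact: next_cons.
  by have [_ + _] := cutP (V, bound st) bV; apply.
have st_cons n : consistent (st n).
  elim: n => [|n IHn]; first by rewrite sts.
  by have [bZ ZnY] := ZY n; rewrite stS; exact: next_cons.
pose u n := reply (st n) (Z n).
have u_legal n : legal (u n) (cut (Z n, bound (st n))).
  by have [bZ ZnY] := ZY n; have [] := reply_legal _ _ (st_cons n) bZ ZnY.
split.
  split=> n; first by have [] := u_legal n.
  have [_ _ fu] := u_legal n; have [_ Zu _] := u_legal n.+1.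
  apply: (finsupp_before (sizeP (u n) fu)) => i.
  have [bZ _] := ZY n.+1; have [_ _ + ui] := cutP (Z n.+1, bound (st n.+1)) bZ.
  by apply => //=; rewrite stS next_bound.
exists (fun n => position (st n)), (fun n => word (st n)); split => /=.
- by rewrite sts.
- by move=> n; rewrite stS next_position.
- move=> n; rewrite stS /next /advance; case: continuation => [|mv nx].
    exists [:: letter (extend (position (st n)) (u n), word (st n))].
    by rewrite /= cats1.
  by exists [::]; rewrite cats0.
have prefix_word i j : (i <= j)%N -> (size (word (st i)) <= size (word (st j)))%N.
  elim: j => [|j IHj]; first by rewrite leqn0 => /eqP ->.
  rewrite leq_eqVlt => /predU1P[->//|/IHj ij]; apply: leq_trans ij _.
  rewrite stS /next /advance; case: continuation => //=.
  by rewrite size_rcons.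
(* Induction on the tree still to be played: its branches are finite, so the current game ends and a
   letter is added. *)
have finish n : exists2 N, (n <= N)%N &
    L (position (st N.+1)) (word (st N.+1)) /\
    size (word (st N.+1)) = (size (word (st N))).+1.
  have [t tn] : exists t, t = Node (moves (st n)) (continuation (st n)).
    by eexists.
  elim: t n tn => [//|mv nx IHnx] n [mvn nxn].
  have [bZ ZnY] := ZY n; have [_] := reply_legal _ _ (st_cons n) bZ ZnY.
  case nxE : (continuation (st n) (cut (Z n, bound (st n)))) => [|mv' nx'].
    move=> Tp; exists n => //; rewrite stS /next /advance nxE /= size_rcons.
    by split => //; exact: (letterP (_, _)).
  move=> _; have [|N nN fN] := IHnx (cut (Z n, bound (st n))) n.+1.
    by rewrite nxn nxE stS /next /advance nxE.
  by exists N => //; exact: ltnW.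
elim=> [|m [n [mn ms _]]]; first by exists 0%N; rewrite sts.
have [N nN [LN sN]] := finish n; exists N.+1; split => //.
  by rewrite ltnS (leq_trans mn).
by rewrite sN ltnS (leq_trans ms)// prefix_word.
Qed.

End Composition.

(** * Passage to the limit *)

Lemma pair_distC (u v : X * K) : pair_dist u v = pair_dist v u.
Proof. by rewrite /pair_dist distrC [`|u.2 - _|]distrC. Qed.

Lemma pair_dist_triangle (v u w : X * K) :
  pair_dist u w <= pair_dist u v + pair_dist v w.
Proof. by rewrite /pair_dist addrACA lerD// ler_distD. Qed.

Lemma pair_dist_lim (w : nat -> X * K) (v d : X * K) (c : K) :
  w k @[k --> \oo] --> v -> (\forall k \near \oo, pair_dist (w k) d <= c) ->
  pair_dist v d <= c.
Proof.
move=> wv wd; apply/ler_addgt0Pr => eps eps0.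
have eps20 : 0 < eps / 2 by rewrite divr_gt0.
have w1 : (w k).1 @[k --> \oo] --> v.1.
  by apply: (@cvg_comp _ _ _ w fst _ (nbhs v) _ wv); exact: cvg_fst.
have w2 : (w k).2 @[k --> \oo] --> v.2.
  by apply: (@cvg_comp _ _ _ w snd _ (nbhs v) _ wv); exact: cvg_snd.
have /cvgrPdist_le/(_ _ eps20) n1 := w1.
have /cvgrPdist_le/(_ _ eps20) n2 := w2.
have [k [[k1 k2] kd]] := filter_ex (filterI (filterI n1 n2) wd).
rewrite (le_trans (pair_dist_triangle (w k) _ _))// addrC lerD//.
by rewrite /pair_dist [leRHS]splitr lerD.
Qed.

(** The words converge to a point [a] of the Baire space. The witnesses [b m] agree with [a] on ever
    longer segments, so by continuity the closeness of [F (b m)] to the approximated moves passes to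
    [F a]. *)
Lemma limit_enlargement (F : {ptws nat -> nat} -> {ptws nat -> (X * K)%type})
    (sigma : set (nat -> X * K)) (delta : nat -> K)
    (L : seq (X * K) -> seq nat -> Prop) (u : nat -> X * K)
    (p : nat -> seq (X * K)) (s : nat -> seq nat) :
  continuous F -> range F = sigma -> (forall n, eta n + eta n <= delta n) ->
  (forall p s, L p s -> exists2 b, agree s b & near_play p (F b)) ->
  Sigma e u -> p 0%N = [::] -> (forall n, p n.+1 = extend (p n) (u n)) ->
  (forall n, exists t, s n.+1 = s n ++ t) ->
  (forall m, exists n, [/\ (m <= n)%N, (m <= size (s n))%N & L (p n) (s n)]) ->
  enlargement e delta sigma u.
Proof.
move=> cF <- eta_delta Lwit Su p0 pS sS often.
have fu i : exists N, finsupp N (u i).1.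
  exact: block_finsupp (Sigma_block Su).
have size_p n : size (p n) = n.
  by elim: n => [|n IHn]; rewrite ?p0// pS size_rcons IHn.
have nth_p n i : (i < n)%N -> nth (0, 0) (p n) i = ap i (u i).
  elim: n => // n IHn; rewrite ltnS leq_eqVlt pS nth_rcons size_p.
  case/predU1P => [->|i_n]; first by rewrite ltnn eqxx.
  by rewrite i_n; exact: IHn.
have prefix_s i j : (i <= j)%N -> exists t, s j = s i ++ t.
  elim: j => [|j IHj]; first by rewrite leqn0 => /eqP ->;
    exists [::]; rewrite cats0.
  rewrite leq_eqVlt => /predU1P[->|/IHj[t sj]];
    first by exists [::]; rewrite cats0.
  by have [t' ->] := sS j; exists (t ++ t'); rewrite sj catA.
have nth_s i j k : (k < size (s i))%N -> (k < size (s j))%N ->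
    nth 0%N (s i) k = nth 0%N (s j) k.
  wlog ij : i j / (i <= j)%N.
    move=> wl ki kj; have [ij|/ltnW ji] := leqP i j; first exact: wl.
    by apply/esym/wl.
  by move=> ki _; have [t ->] := prefix_s _ _ ij; rewrite nth_cat ki.
have [nn nnP] := choice often.
(* The word at stage [nn i.+1] has more than [i] letters, so the default 0 is never read. *)
pose a i := nth 0%N (s (nn i.+1)) i.
have [b bP] : exists b : nat -> nat -> nat, forall m,
    agree (s (nn m)) (b m) /\ near_play (p (nn m)) (F (b m)).
  have [|b bP] := @choice _ _ (fun m b =>
      agree (s (nn m)) b /\ near_play (p (nn m)) (F b)).
    by move=> m; have [_ _ /Lwit[b sb pb]] := nnP m; exists b.
  by exists b.
have ba i : \forall m \near \oo, b m i = a i.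
  exists i.+1 => // m /= im; have [sb _] := bP m.
  have [_ ims _] := nnP m; have si := leq_trans im ims.
  by rewrite sb// /a; apply: nth_s => //; have [] := nnP i.+1.
have Fa i : pair_dist (F a i) (ap i (u i)) <= eta i.
  have Fbi := @ptws_cvg _ _ _ _ cF ba i.
  apply: (@pair_dist_lim (fun k => F (b k) i)); first exact: Fbi.
  exists i.+1 => // m /= im.
  have [imn _ _] := nnP m; have [_ pb] := bP m.
  rewrite -(@nth_p (nn m)) ?(leq_trans im)//.
  by apply: pb; rewrite size_p (leq_trans im).
split => //; exists (F a); split; first by exists a.
(* One [eta n] pays for rounding the move, the other for the distance from the rounded move to
   [F a]. *)
move=> n; rewrite (le_trans _ (eta_delta n))//.
rewrite (le_trans (pair_dist_triangle (ap n (u n)) _ _))// lerD//.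
  by have [] := apP n (Su.1 n) (fu n).
by rewrite pair_distC.
Qed.

End Positions.

(** * The basis as a block sequence, and the conclusion *)

Lemma coord_basis n i : coord (e n) i = (i == n)%:R.
Proof.
rewrite (@expansion_coord (fun i => (i == n)%:R))// /is_expansion.
apply: cvg_near_cst; exists n.+1 => // m /= nm.
rewrite /series/= big_mkord (bigD1 (Ordinal nm))//= eqxx scale1r big1 ?addr0//.
by move=> j /negbTE jn; rewrite -val_eqE/= in jn; rewrite jn scale0r.
Qed.

Lemma basis_block : block e.
Proof.
split=> n; first by rewrite -normr_eq0 normalized_e oner_eq0.
apply/beforeE => i j; rewrite !coord_basis !pnatr_eq0 !eqb0 !negbK.
by move=> /eqP -> /eqP ->.
Qed.

Lemma strategically_large_sub (target target' : set (nat -> X * K)) Y :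
  target `<=` target' -> strategically_large e target Y ->
  strategically_large e target' Y.
Proof.
move=> tt' [st stP]; exists st => Z ZY.
by have [legalZ winZ] := stP Z ZY; split => //; exact: tt'.
Qed.

End Gowers.

Theorem theorem4p1 (R : realType) (K : numFieldType)
    (scalarsK : real_or_complex R K)
    (X : completeNormedModType K) (e : nat -> X)
    (basis_e : schauder_basis e) (normalized_e : normalized e)
    (monotone_e : monotone_basis e)
    (sigma : set (nat -> X * K)) (sub_sigma : sigma `<=` Sigma e)
    (analytic_sigma : N_analytic sigma) (large_sigma : large e sigma)
    (delta : nat -> K) (delta_gt0 : forall n, 0 < delta n) :
  exists Y : set X,
    block_subspace e Y /\
    strategically_large e (enlargement e delta sigma) Y.
Proof.
have bX := block_cspan (basis_block basis_e normalized_e).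
case: analytic_sigma => [sigma0|[F [cF rangeF]]].
  (* A large set is nonempty, so [sigma] is the range of some continuous [F]. *)
  by have [s [+ _]] := large_sigma _ bX; rewrite sigma0.
pose eta n := delta n / 2.
have eta0 n : 0 < eta n by rewrite divr_gt0.
have [ap [A [subA apP]]] :=
  approximation basis_e normalized_e monotone_e scalarsK eta0.
have SigmaF b : Sigma e (F b) by apply: sub_sigma; rewrite -rangeF; exists b.
(* At the empty position and the empty word, being large is just the largeness of [sigma]. *)
have largeX : large_at e eta F (cspan e) [::] [::].
  move=> V bV _; have [w [+ wV]] := large_sigma V bV.
  by rewrite -rangeF => -[b _ bw]; exists b; split => // i _; rewrite bw.
have [Y [L [bY L0 Lwit Lreach]]] :=
  large_reachable basis_e normalized_e monotone_e subA apP SigmaF bX largeX.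
exists Y; split => //.
apply: strategically_large_sub
  (composition basis_e normalized_e monotone_e subA apP Lreach L0).
move=> u [Su [p [s [p0 pS sS often]]]].
have eta_delta n : eta n + eta n <= delta n by rewrite -splitr.
exact: (limit_enlargement basis_e apP cF rangeF eta_delta Lwit Su p0 pS sS
  often).
Qed.
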